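(* Let $\mathbb{D}^n_{2n}=\{d_1,d_2,\dots,d_{2n}\}$ be a maximal positive basis of $\mathbb{R}^n$. Then $$\gamma_{\mathbf{B}}=\mathring{p}_{\mathbf{B}}$$ for all bases $\mathbf{B}\subset\mathbb{D}^n_{2n}$ of $\mathbb{R}^n$, where $\gamma_{\mathbf{B}}$ and $\mathring{p}_{\mathbf{B}}$ are as defined in the context. Moreover, $$\operatorname{cm}(\mathbb{D}^n_{2n})=\min_{\mathbf{B}\subset\mathbb{D}^n_{2n}}\gamma_{\mathbf{B}},$$ where the minimum is over all bases of $\mathbb{R}^n$ contained in $\mathbb{D}^n_{2n}$.
   Context: The positive span of a finite set $S=\{d_1,\dots,d_s\}\subset\mathbb{R}^n$ is $\operatorname{pspan}(S)=\{\alpha_1d_1+\dots+\alpha_sd_s:\alpha_i\ge 0,\ i=1,\dots,s\}$. $S$ is positively independent if $d_i\notin\operatorname{pspan}(S\setminus\{d_i\})$ for all $i$. A positive basis of $\mathbb{R}^n$ of size $s$ is a positively independent set of $s$ vectors whose positive span is $\mathbb{R}^n$; it is called maximal if $s=2n$. A finite set of vectors is also regarded as the matrix whose columns are its vectors. $\|\cdot\|$ is the Euclidean norm. The cosine measure of a positive basis $\mathbb{D}$ of $\mathbb{R}^n$ is $$\operatorname{cm}(\mathbb{D})=\min_{u\in\mathbb{R}^n,\ \|u\|=1}\ \max_{d\in\mathbb{D}}\frac{u^\top d}{\|d\|}.$$ For a positive basis $\mathbb{D}=\{d_1,\dots,d_s\}$ of $\mathbb{R}^n$ and a basis $\mathbf{B}\subset\mathbb{D}$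 of $\mathbb{R}^n$, let $\mathbf{G}(\mathbf{B})$ be the Gram matrix of $\mathbf{B}$ (the $n\times n$ matrix of dot products of the vectors of $\mathbf{B}$), let $\mathbf{1}\in\mathbb{R}^n$ be the all-ones vector, and define $$\gamma_{\mathbf{B}}=\frac{1}{\sqrt{\mathbf{1}^\top\mathbf{G}(\mathbf{B})^{-1}\mathbf{1}}},\qquad u_{\mathbf{B}}=\mathbf{B}^{-\top}\gamma_{\mathbf{B}}\mathbf{1},\qquad p_{\mathbf{B}}=[\,p_{\mathbf{B}}^1\ \cdots\ p_{\mathbf{B}}^s\,]=u_{\mathbf{B}}^\top\mathbb{D},\qquad \mathring{p}_{\mathbf{B}}=\max_{1\le i\le s}p_{\mathbf{B}}^i .$$
   Formalization: The formula for cm is proved for maximal positive bases of unit vectors; as stated it fails for other lengths (n=1, D={2,-2}: cm=1 but γ_B=2), because cm normalizes the vectors and γ_B does not. The first claim is proved without this assumption. *)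

(* Defs.v *)
From HB Require Import structures.
From mathcomp Require Import all_boot all_order all_algebra.
From mathcomp Require Import boolp classical_sets reals.

Set Implicit Arguments.
Unset Strict Implicit.
Unset Printing Implicit Defensive.

Import Order.TTheory GRing.Theory Num.Theory.
Local Open Scope classical_set_scope.
Local Open Scope ring_scope.

(* A finite set of s vectors of R^n is the matrix 'M_(n, s) of its columns. *)

Section Extrema.
Context {R : realType}.
Implicit Type A : set R.

(* The attained maximum and minimum of a set; the value is 0 if there is none,
   unlike sup and inf, which do not have to belong to the set. *)
Definition greatest A : R := xget 0 (A `&` ubound A).
Definition least A : R := xget 0 (A `&` lbound A).

Lemma greatestE A m : A m -> ubound A m -> greatest A = m.
Proof.
move=> Am ubm; apply: xget_unique; first by split.
by move=> y [Ay uby]; apply/le_anti; rewrite ubm //= uby.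
Qed.

Lemma leastE A m : A m -> lbound A m -> least A = m.
Proof.
move=> Am lbm; apply: xget_unique; first by split.
by move=> y [Ay lby]; apply/le_anti; rewrite lby //= lbm.
Qed.

End Extrema.

Section CosineMeasure.
Context {R : realType} {n : nat}.

Definition dot (u v : 'cV[R]_n) : R := (u^T *m v) 0 0.

(* The Euclidean norm: `|_| on matrices is the sup norm. *)
Definition enorm (u : 'cV[R]_n) : R := Num.sqrt (dot u u).

Definition cols s (M : 'M[R]_(n, s)) : seq 'cV[R]_n :=
  [seq col j M | j <- enum 'I_s].

Definition pspan s (D : 'M[R]_(n, s)) (J : {set 'I_s}) : set 'cV[R]_n :=
  [set v | exists2 a : 'I_s -> R,
     forall j, 0 <= a j & v = \sum_(j in J) a j *: col j D].

(* Removing the index i rather than the vector col i D makes a repeated column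
   violate the condition, so the s columns are s distinct vectors. *)
Definition pos_independent s (D : 'M[R]_(n, s)) : Prop :=
  forall i, ~ pspan D [set~ i]%SET (col i D).

Definition pos_basis s (D : 'M[R]_(n, s)) : Prop :=
  pos_independent D /\ pspan D [set: 'I_s]%SET = [set: 'cV[R]_n].

Definition max_pos_basis s (D : 'M[R]_(n, s)) : Prop :=
  pos_basis D /\ s = (2 * n)%N.

Definition cm s (D : 'M[R]_(n, s)) : R :=
  least [set greatest [set dot u (col j D) / enorm (col j D) | j in [set: 'I_s]]
        | u in [set u | enorm u = 1]].

(* The columns of B, in any order, form a basis of R^n contained in D. *)
Definition basis_in s (D : 'M[R]_(n, s)) (B : 'M[R]_n) : Prop :=
  basis_of {: 'cV[R]_n}%VS (cols B) /\ {subset cols B <= cols D}.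

Definition gram (B : 'M[R]_n) : 'M[R]_n :=
  \matrix_(i, j) dot (col i B) (col j B).

Definition ones : 'cV[R]_n := const_mx 1.

(* gamma depends on the lengths of the columns of B, whereas cm does not depend
   on the lengths of the columns of D: they are comparable for unit vectors. *)
Definition gamma (B : 'M[R]_n) : R :=
  1 / Num.sqrt ((ones^T *m invmx (gram B) *m ones) 0 0).

Definition uvec (B : 'M[R]_n) : 'cV[R]_n := (invmx B)^T *m (gamma B *: ones).

Definition pvec s (D : 'M[R]_(n, s)) (B : 'M[R]_n) : 'rV[R]_s :=
  (uvec B)^T *m D.

Definition pmax s (D : 'M[R]_(n, s)) (B : 'M[R]_n) : R :=
  greatest [set pvec D B 0 i | i in [set: 'I_s]].

End CosineMeasure.

(* Main.v *)
Require Import Defs.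
From mathcomp Require Import boolp classical_sets reals.
From mathcomp Require Import all_boot all_order all_algebra.
From mathcomp Require Import zify ring lra.
Set Implicit Arguments.
Unset Strict Implicit.
Unset Printing Implicit Defensive.
Import Order.TTheory GRing.Theory Num.Theory.
Local Open Scope ring_scope.

(* Structure of a maximal positive basis: if a subset C spans positively its own
   linear span, a minimal positive circuit modulo that span, formed by a vector
   outside C and k >= 1 further vectors, enlarges C by k + 1 elements and the
   dimension by k.  Hence at most 2 (n - dim C) vectors lie outside C.  Starting
   from C empty, 2n vectors force k = 1: the negative of each vector is, up to a
   positive factor, in the positive basis.  A basis B in D thus picks one vector
   from each antipodal pair, and u_B takes the value gamma_B on B and negative
   values on the other vectors of D.

   For the cosine measure, let u be a unit vector and m the maximum of u . d over
   D.  Choosing the signs in the pairs gives a basis B in D with u = \sum_i a_i b_i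
   and a_i >= 0.  Then 1 = u . u <= m \sum_i a_i, whereas
   gamma_B \sum_i a_i = u_B . u <= 1, so gamma_B <= m; and u_B attains gamma_B. *)

(** * Cones, linear spans and positive circuits modulo a subspace *)

Section PositiveSpan.
Context {R : realFieldType} {V : vectType R} {I : finType} (d : I -> V).
Implicit Types (C E : {set I}) (U : {vspace V}).

(** For the family of columns of a matrix this unfolds to [pspan]. *)
Definition cone C (v : V) : Prop :=
  exists2 a : I -> R, forall i, 0 <= a i & v = \sum_(i in C) a i *: d i.

Definition linspan C : {vspace V} := (\sum_(i in C) <[d i]>)%VS.

(** Linear independence of the family [E] in the quotient of [V] by [U]. *)
Definition free_mod U E : Prop := forall b : I -> R,
  \sum_(i in E) b i *: d i \in U -> forall i, i \in E -> b i = 0.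

Lemma cone0 C : cone C 0.
Proof. by exists (fun=> 0) => //; rewrite big1 // => i _; rewrite scale0r. Qed.

Lemma coneD C u v : cone C u -> cone C v -> cone C (u + v).
Proof.
move=> [a a0 ->] [b b0 ->]; exists (fun i => a i + b i).
  by move=> i; rewrite addr_ge0.
by rewrite -big_split; apply: eq_bigr => i _; rewrite scalerDl.
Qed.

Lemma coneZ C c v : 0 <= c -> cone C v -> cone C (c *: v).
Proof.
move=> c0 [a a0 ->]; exists (fun i => c * a i).
  by move=> i; rewrite mulr_ge0.
by rewrite scaler_sumr; apply: eq_bigr => i _; rewrite scalerA.
Qed.

Lemma cone_sum (J : finType) (P : pred J) (F : J -> V) C :
  (forall j, P j -> cone C (F j)) -> cone C (\sum_(j | P j) F j).
Proof.
by move=> h; apply: (big_ind (cone C)) => //; [exact: cone0|exact: coneD].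
Qed.

Lemma cone_gen C i : i \in C -> cone C (d i).
Proof.
move=> iC; exists (fun k => (k == i)%:R); first by move=> k; rewrite ler0n.
rewrite (bigD1 i) //= eqxx scale1r big1 ?addr0 // => k /andP[_ /negPf->].
by rewrite scale0r.
Qed.

Lemma coneS C E v : C \subset E -> cone C v -> cone E v.
Proof.
move=> /subsetP CE [a a0 ->]; apply: cone_sum => i iC.
by apply: coneZ => //; apply: cone_gen; apply: CE.
Qed.

Lemma linspanP C v : v \in linspan C ->
  exists b : I -> R, v = \sum_(i in C) b i *: d i.
Proof.
case/memv_sumP=> vs hvs ->.
have /choice[b hb] : forall i, exists k : R, i \in C -> vs i = k *: d i.
  move=> i; have [/hvs/vlineP[k ->]|_] := boolP (i \in C); last by exists 0.
  by exists k.
by exists b; apply: eq_bigr.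
Qed.

Lemma mem_linspan C (b : I -> R) : \sum_(i in C) b i *: d i \in linspan C.
Proof.
apply: memv_suml => i iC; apply: memvZ.
by apply: subvP (memv_line (d i)); apply: (sumv_sup i).
Qed.

Lemma cone_linspan C v : cone C v -> v \in linspan C.
Proof. by move=> [a _ ->]; exact: mem_linspan. Qed.

(** A coefficient of either sign is absorbed by [d i] or by [- d i]. *)
Lemma linspan_cone C E v : (forall i, i \in C -> cone E (d i)) ->
  (forall i, i \in C -> cone E (- d i)) -> v \in linspan C -> cone E v.
Proof.
move=> hp hn /linspanP[b ->]; apply: cone_sum => i iC.
have [b0|b0] := leP 0 (b i); first exact: coneZ (hp i iC).
by rewrite -[b i]opprK scaleNr -scalerN; apply: coneZ (hn i iC); lra.
Qed.

Lemma dim_free_mod U E : free_mod U E ->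
  \dim (U + linspan E)%VS = (\dim U + #|E|)%N.
Proof.
have [k] := ubnP #|E|; elim: k => // k IHk in E *; rewrite ltnS => leEk frE.
have [->|[i iE]] := set_0Vmem E.
  by rewrite /linspan big_set0 addv0 cards0 addn0.
have frE' : free_mod U (E :\ i).
  move=> b bU j jE; have /setD1P[ji jE'] := jE.
  have := frE (fun l => if l == i then 0 else b l); rewrite (big_setD1 i) //=.
  rewrite eqxx scale0r add0r.
  under eq_bigr => l /setD1P[/negPf-> _] do over.
  by move=> /(_ bU j jE'); rewrite (negPf ji).
have cE := cardsD1 i E; rewrite iE in cE.
have /IHk -/(_ frE') dimE' : (#|E :\ i| < k)%N by lia.
(* Otherwise there is a relation modulo [U] on [E] with coefficient 1 at [i]. *)
have idU : d i \notin (U + linspan (E :\ i))%VS.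
  apply/negP => /memv_addP[u uU [w /linspanP[b ->] e]].
  have := frE (fun l => if l == i then 1 else - b l); rewrite (big_setD1 i) //=.
  rewrite eqxx scale1r.
  have -> : \sum_(l in E :\ i) (if l == i then 1 else - b l) *: d l =
      - \sum_(l in E :\ i) b l *: d l.
    rewrite -sumrN; apply: eq_bigr => l /setD1P[/negPf-> _].
    by rewrite scaleNr.
  rewrite e addrK => /(_ uU i iE); rewrite eqxx => /eqP.
  by rewrite oner_eq0.
have -> : linspan E = (<[d i]> + linspan (E :\ i))%VS.
  by rewrite /linspan (big_setD1 i).
rewrite addvA [(U + _)%VS]addvC -addvA dimv_disjoint_sum; last first.
  apply/eqP; rewrite -subv0; apply/subvP => w; rewrite memv_cap memv0.
  case/andP=> /vlineP[c ->]; have [->|c0] := eqVneq c 0; first by rewrite scale0r.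
  by move=> /(memvZ c^-1); rewrite scalerA mulVf // scale1r (negPf idU).
have di0 : d i != 0 by apply: contraNneq idU => ->; rewrite mem0v.
by rewrite dimE' dim_vline di0; lia.
Qed.

(* Carathéodory's theorem modulo [U]: at a support [E] that is minimal, a
   nontrivial relation modulo [U] would allow a coefficient to be cancelled. *)
Lemma caratheodory_mod U (P : {set I}) (a : I -> R) v :
  (forall i, 0 <= a i) -> v + \sum_(i in P) a i *: d i \in U ->
  exists E (c : I -> R), [/\ E \subset P, free_mod U E,
    forall i, i \in E -> 0 < c i & v + \sum_(i in E) c i *: d i \in U].
Proof.
move=> a0 aU.
pose Q E := `[< exists2 c : I -> R, forall i, i \in E -> 0 <= c i &
                v + \sum_(i in E) c i *: d i \in U >].
have QP : Q P by apply/asboolP; exists a.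
have [E /minsetP[/asboolP[c c0 cU] minE] EP] := minset_exists QP.
have pos b : (forall i, i \in E -> 0 <= b i) ->
    v + \sum_(i in E) b i *: d i \in U -> forall i, i \in E -> b i != 0.
  move=> b0 bU i iE; apply/eqP => bi0.
  have /minE/(_ (subD1set _ _)) Ei : Q (E :\ i).
    apply/asboolP; exists b; first by move=> j /setD1P[_ /b0].
    by move: bU; rewrite (big_setD1 i) //= bi0 scale0r add0r.
  by have := iE; rewrite -Ei setD11.
exists E, c; split=> //; last first.
  by move=> i iE; rewrite lt_def pos ?c0.
have nopos b i : \sum_(i in E) b i *: d i \in U -> i \in E -> b i <= 0.
  move=> bU iE; rewrite leNgt; apply/negP => bi.
  have Pi : (i \in E) && (0 < b i) by rewrite iE.
  case: (@arg_minP _ _ _ i (fun l => (l \in E) && (0 < b l))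
    (fun l => c l / b l) Pi) => j /andP[jE bj] minj.
  (* Subtracting [t] times the relation [b], with [t] the least ratio over positive [b l], keeps all
     coefficients nonnegative and cancels the one at [j], against [pos]. *)
  pose t := c j / b j.
  have /(pos (fun l => c l - t * b l)) : forall l, l \in E -> 0 <= c l - t * b l.
    move=> l lE; rewrite subr_ge0; have [bl|bl] := ltP 0 (b l).
      by rewrite -ler_pdivlMr //; apply: minj; rewrite lE.
    apply: le_trans (c0 l lE); rewrite mulr_ge0_le0 //.
    by rewrite divr_ge0 ?c0 ?ltW.
  move=> nz.
  have /nz/(_ j jE) : v + \sum_(l in E) (c l - t * b l) *: d l \in U; last first.
    by rewrite /t divfK ?subrr ?eqxx // gt_eqF.
  rewrite (_ : _ + _ = (v + \sum_(l in E) c l *: d l) -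
    t *: \sum_(l in E) b l *: d l); first by rewrite rpredB ?memvZ.
  rewrite -addrA; congr (_ + _); rewrite scaler_sumr -sumrB.
  by apply: eq_bigr => l _; rewrite scalerBl scalerA.
move=> b bU i iE; apply/le_anti; rewrite nopos //= -oppr_le0.
apply: (nopos (fun i => - b i)) => //.
by under eq_bigr do rewrite scaleNr; rewrite sumrN rpredN.
Qed.

(* When [cone C] is a linear space, a vector [d j] outside it lies on a minimal
   positive circuit modulo that space, and adding the circuit keeps the property. *)
Lemma extend_linear C j : (forall v, cone [set: I] v) ->
  (forall i, i \in C -> cone C (- d i)) -> j \notin C ->
  exists E (c : I -> R), let C' := j |: (C :|: E) in
  [/\ [disjoint E & j |: C], forall i, i \in E -> 0 < c i,
      d j + \sum_(i in E) c i *: d i \in linspan C,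
      (\dim (linspan C) + #|E| <= \dim (linspan C'))%N &
      forall i, i \in C' -> cone C' (- d i)].
Proof.
move=> full Cneg jC; have [a a0 ja] := full (- d j).
(* The positive relation [d j + \sum_i a i *: d i = 0], scaled to have coefficient 1 at [j]. *)
pose b i := (a i + (i == j)%:R) / (a j + 1).
have bj : b j = 1 by rewrite /b eqxx divff // gt_eqF // ltr_wpDl.
have b0 i : 0 <= b i by rewrite divr_ge0 ?addr_ge0 ?a0.
have sb : \sum_(i in [set: I]) b i *: d i = 0.
  under eq_bigr do rewrite /b mulrC -scalerA scalerDl.
  rewrite -scaler_sumr big_split /= -ja (big_setD1 j) ?inE //= eqxx scale1r.
  rewrite big1 ?addr0 ?addNr ?scaler0 // => i /setD1P[/negPf-> _].
  by rewrite scale0r.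
(* The terms indexed by [C] vanish modulo [linspan C]. *)
have Pj : d j + \sum_(i in (~: C) :\ j) b i *: d i \in linspan C.
  rewrite -[d j]scale1r -bj -(big_setD1 j) ?inE //=.
  move: sb; rewrite (big_setID C) /= setTI setTD addrC => /eqP.
  by rewrite addr_eq0 => /eqP->; rewrite rpredN mem_linspan.
have [E [c [EP frE c0 cU]]] := caratheodory_mod b0 Pj.
have EC i : i \in E -> i \notin j |: C.
  by move=> /(subsetP EP); rewrite !inE negb_or.
exists E, c => C'.
have CC' : C \subset C' by apply/subsetP => i iC; rewrite !inE iC orbT.
have EC' : E \subset C' by apply/subsetP => i iE; rewrite !inE iE !orbT.
have jC' : j \in C' by rewrite !inE eqxx.
have UC' v : v \in linspan C -> cone C' v.
  apply: linspan_cone => i iC; first exact/cone_gen/(subsetP CC').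
  by apply: coneS CC' _; exact: Cneg.
split=> //.
- by rewrite disjoint_subset; apply/subsetP => i /EC.
- rewrite -dim_free_mod //; apply: dimvS; apply/subvP => w /memv_addP[u].
  move=> /linspanP[e ->] [w' /linspanP[f ->] ->].
  apply: memvD; apply: memv_suml => i iC; apply: memvZ; apply: cone_linspan.
    exact/cone_gen/(subsetP CC').
  exact/cone_gen/(subsetP EC').
move=> i; rewrite !inE => /or3P[/eqP->|iC|iE].
(* The circuit lies in [linspan C], hence in [cone C'] with either sign: the negative of one of its
   terms is the sum of the others minus the circuit. *)
- rewrite (_ : - d j = \sum_(i in E) c i *: d i -
    (d j + \sum_(i in E) c i *: d i)); last by rewrite opprD addrC subrK.
  apply: coneD; last by apply: UC'; rewrite rpredN.
  apply: cone_sum => k kE; apply: coneZ; first exact/ltW/c0.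
  exact/cone_gen/(subsetP EC').
- exact: coneS CC' (Cneg i iC).
rewrite (_ : - d i = (c i)^-1 *: (- (c i *: d i))); last first.
  by rewrite scalerN scalerA mulVf ?scale1r // gt_eqF ?c0.
apply: coneZ; first by rewrite invr_ge0 ltW ?c0.
rewrite (_ : - _ = d j + \sum_(k in E :\ i) c k *: d k -
    (d j + \sum_(k in E) c k *: d k)); last first.
  rewrite [X in _ - (_ + X)](big_setD1 i) //= opprD addrACA subrr add0r.
  by rewrite opprD addrCA subrr addr0.
apply: coneD; last by apply: UC'; rewrite rpredN.
apply: coneD; first exact: cone_gen.
apply: cone_sum => k /setD1P[_ kE]; apply: coneZ; first exact/ltW/c0.
exact/cone_gen/(subsetP EC').
Qed.

(** * Counting the vectors of a positive basis *)

Hypothesis indep : forall i, ~ cone [set~ i] (d i).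
Hypothesis full : forall v, cone [set: I] v.

(** With [E] empty, [d j] would lie in [linspan C], which [cone C] contains, although [j] is not in
    [C]. *)
Lemma extension_nonempty C j E (c : I -> R) :
  (forall i, i \in C -> cone C (- d i)) -> j \notin C ->
  d j + \sum_(i in E) c i *: d i \in linspan C -> (0 < #|E|)%N.
Proof.
move=> Cneg jC; rewrite card_gt0; apply: contraTneq => ->.
rewrite big_set0 addr0; apply/negP => dj; apply: (@indep j).
apply: coneS (linspan_cone _ Cneg dj); last exact: cone_gen.
by apply/subsetP => i iC; rewrite !inE; apply: contraNneq jC => <-.
Qed.

(** An extension takes [#|E| + 1] indices from the complement and adds at least [#|E|] to the
    dimension; [#|E| + 1 <= 2 * #|E|] because [E] is nonempty. *)
Lemma card_compl_linear C : (forall i, i \in C -> cone C (- d i)) ->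
  (#|~: C| + 2 * \dim (linspan C) <= 2 * \dim {:V})%N.
Proof.
have [k] := ubnP #|~: C|; elim: k => // k IHk in C *; rewrite ltnS => leCk Cneg.
have [C0|[j]] := set_0Vmem (~: C).
  by rewrite C0 cards0 add0n leq_mul2l dimvS ?subvf.
rewrite inE => jC; have [E [c /=]] := extend_linear full Cneg jC.
set C' := _ |: (_ :|: _) => -[dis c0 dj dimC' C'neg].
have E0 := extension_nonempty Cneg jC dj.
have card : #|C'| = (#|C| + #|E| + 1)%N.
  rewrite /C' setUA cardsU disjoint_setI0; last by rewrite disjoint_sym.
  by rewrite cards0 subn0 cardsU1 jC; lia.
have := cardsC C; have := cardsC C' => cC' cC.
have /IHk/(_ C'neg) : (#|~: C'| < k)%N by lia.
lia.
Qed.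

(** Extending the empty set gives [#|E| + 1] indices of dimension at least [#|E|]. The bound on the
    complement then forces [#|E| <= 1], and the circuit is an exact relation between two vectors. *)
Lemma antipode j : (#|I| = 2 * \dim {:V})%N ->
  exists k, exists2 l, 0 < l & d k = - (l *: d j).
Proof.
move=> cardI; have neg0 : forall i, i \in set0 -> cone set0 (- d i).
  by move=> i; rewrite inE.
have j0 : j \notin (set0 : {set I}) by rewrite inE.
have [E [c /=]] := extend_linear full neg0 j0.
set C' := _ |: (_ :|: _) => -[dis c0 dj dimC' C'neg].
have E0 := extension_nonempty neg0 j0 dj.
have card : #|C'| = (#|E| + 1)%N.
  rewrite setU0 in dis.
  rewrite /C' set0U cardsU1; have := disjointFl dis (set11 j) => ->.
  by rewrite addnC.
have := cardsC C'; have := card_compl_linear C'neg => bd cC'.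
have /eqP/cards1P[k Ek] : #|E| = 1%N.
  by have := leqnn #|I|; move: (\dim (linspan set0)) dimC'; lia.
have ck : 0 < c k by rewrite c0 // Ek set11.
exists k, (c k)^-1; rewrite ?invr_gt0 //.
move: dj; rewrite Ek big_set1 /linspan big_set0 memv0 addrC addr_eq0 => /eqP e.
by rewrite -scalerN -e scalerA mulVf ?scale1r // gt_eqF.
Qed.

End PositiveSpan.

Local Open Scope classical_set_scope.

(** * Dot products, Gram matrices and the vector [uvec B] *)

Section CosineMeasure.
Context {R : realType} {n : nat}.
Implicit Types (u v : 'cV[R]_n) (B : 'M[R]_n).

Lemma dotE u v : dot u v = \sum_i u i 0 * v i 0.
Proof. by rewrite /dot mxE; apply: eq_bigr => i _; rewrite mxE. Qed.

Lemma dot_ge0 u : 0 <= dot u u.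
Proof. by rewrite dotE sumr_ge0 // => i _; rewrite -expr2 sqr_ge0. Qed.

Lemma dot_eq0 u : dot u u = 0 -> u = 0.
Proof.
rewrite dotE => /eqP; rewrite psumr_eq0 => [/allP h|i _]; last first.
  by rewrite -expr2 sqr_ge0.
apply/colP => i; rewrite mxE; apply/eqP.
by have := h i (mem_index_enum _); rewrite /= mulf_eq0 orbb.
Qed.

Lemma dotNr u v : dot u (- v) = - dot u v.
Proof. by rewrite /dot mulmxN mxE. Qed.

Lemma dotZr u v c : dot u (c *: v) = c * dot u v.
Proof. by rewrite /dot -scalemxAr mxE. Qed.

Lemma dotZl u v c : dot (c *: u) v = c * dot u v.
Proof. by rewrite !dotE mulr_sumr; apply: eq_bigr => i _; rewrite mxE mulrA. Qed.

Lemma dot_col s u (A : 'M[R]_(n, s)) j : dot u (col j A) = (u^T *m A) 0 j.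
Proof. by rewrite /dot !mxE; apply: eq_bigr => i _; rewrite [col _ _ _ _]mxE. Qed.

Lemma dot_mul u B (x : 'cV[R]_n) :
  dot u (B *m x) = \sum_i dot u (col i B) * x i 0.
Proof.
by rewrite /dot mulmxA mxE; apply: eq_bigr => i _; rewrite -dot_col.
Qed.

Lemma enorm1 u : (enorm u = 1) <-> (dot u u = 1).
Proof.
rewrite /enorm; split=> [h|->]; last by rewrite sqrtr1.
by rewrite -[dot u u]sqr_sqrtr ?dot_ge0 // h expr1n.
Qed.

(** Cauchy-Schwarz for unit vectors, from the nonnegativity of [dot (u - v) (u - v)]. *)
Lemma dot_le1 u v : enorm u = 1 -> enorm v = 1 -> dot u v <= 1.
Proof.
move=> /enorm1 uu /enorm1 vv; have := dot_ge0 (u - v).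
have -> : dot (u - v) (u - v) = dot u u - 2 * dot u v + dot v v.
  rewrite !dotE mulr_sumr -sumrB -big_split; apply: eq_bigr => i _.
  by rewrite !mxE /=; ring.
by rewrite uu vv; lra.
Qed.

(** On a nonempty finite family [greatest] is attained, so its default 0 does not intervene. *)
Lemma greatest_finite (I : finType) (i0 : I) (F : I -> R) :
  exists2 i, greatest [set F j | j in [set: I]] = F i & forall j, F j <= F i.
Proof.
have [i _ Fi] := @arg_maxP _ _ _ i0 xpredT F isT.
exists i; last by move=> j; apply: Fi.
by apply: greatestE; [exists i|move=> _ [j _ <-]; exact: Fi].
Qed.

Lemma dim_cV : \dim {: 'cV[R]_n} = n.
Proof. by rewrite dimvf dim_matrix; exact: muln1. Qed.

Lemma basis_colsP B : basis_of {: 'cV[R]_n}%VS (cols B) <-> B \in unitmx.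
Proof.
split=> [|uB].
  move=> /andP[/eqP sB _].
  have surj v : exists x, v = B *m x.
    suff : v \in limg (linfun (mulmx B)).
      by case/memv_imgP => x _ ->; exists x; rewrite lfunE.
    apply: subvP (memvf v); rewrite -{1}sB; apply/span_subvP => _ /mapP[j _ ->].
    by rewrite colE -[B *m _](lfunE (mulmx B)) memv_img ?memvf.
  (* Preimages of the unit vectors are the columns of a right inverse of [B]. *)
  have [X hX] := choice (fun j : 'I_n => surj (col j 1%:M)).
  suff /mulmx1_unit[] : B *m (\matrix_(i, j) X j i 0) = 1%:M by [].
  apply/matrixP => i j; have /colP/(_ i) := hX j; rewrite [LHS]mxE => ->.
  by rewrite !mxE; apply: eq_bigr => k _; rewrite !mxE.
rewrite basisEdim dim_cV /cols size_map size_enum_ord leqnn.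
rewrite andbT; apply/subvP => v _; rewrite -[v]mul1mx -(mulmxV uB) -mulmxA.
set x := _ *m v; suff -> : B *m x = \sum_i x i 0 *: col i B.
  apply: memv_suml => i _; apply: memvZ; apply: memv_span.
  by apply/mapP; exists i; rewrite ?mem_enum.
apply/colP => i; rewrite mxE summxE; apply: eq_bigr => k _.
by rewrite !mxE mulrC.
Qed.

Lemma gramE B : gram B = B^T *m B.
Proof.
apply/matrixP => i j; rewrite mxE dot_col !mxE.
by apply: eq_bigr => k _; rewrite !mxE.
Qed.

(** The inverse Gram matrix is [invmx B *m (invmx B)^T]; thus [gamma B] is the factor that
    normalizes [(invmx B)^T *m ones]. *)
Lemma gram_form B : B \in unitmx ->
  ((@ones R n)^T *m invmx (gram B) *m ones) 0 0 =
  dot ((invmx B)^T *m ones) ((invmx B)^T *m ones).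
Proof.
move=> uB; have uBt : B^T \in unitmx by rewrite unitmx_tr.
suff -> : invmx (gram B) = invmx B *m (invmx B)^T.
  by rewrite /dot trmx_mul trmxK !mulmxA.
have uG : gram B \in unitmx by rewrite gramE unitmx_mul uBt.
apply: (can_inj (mulKmx uG)); rewrite mulmxV // gramE -!mulmxA.
by rewrite (mulmxA B) mulmxV // mul1mx trmx_inv mulmxV.
Qed.

Hypothesis n0 : (0 < n)%N.

Lemma gram_form_gt0 B : B \in unitmx ->
  0 < ((@ones R n)^T *m invmx (gram B) *m ones) 0 0.
Proof.
move=> uB; rewrite gram_form // lt_def dot_ge0 andbT; apply/eqP => /dot_eq0.
move/(congr1 (mulmx B^T)); rewrite mulmxA -trmx_mul mulVmx // trmx1 mul1mx.
rewrite mulmx0 => /colP/(_ (Ordinal n0)); rewrite !mxE => /eqP.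
by rewrite oner_eq0.
Qed.

Lemma gamma_gt0 B : B \in unitmx -> 0 < gamma B.
Proof. by move=> uB; rewrite divr_gt0 // sqrtr_gt0 gram_form_gt0. Qed.

Lemma enorm_uvec B : B \in unitmx -> enorm (uvec B) = 1.
Proof.
move=> uB; apply/enorm1; rewrite /uvec -scalemxAr dotZl dotZr -gram_form //.
rewrite mulrA -expr2 /gamma expr_div_n expr1n sqr_sqrtr ?ltW ?gram_form_gt0 //.
by rewrite div1r mulVf // gt_eqF ?gram_form_gt0.
Qed.

Lemma dot_uvec_col B i : B \in unitmx -> dot (uvec B) (col i B) = gamma B.
Proof.
move=> uB; rewrite dot_col /uvec trmx_mul trmxK -mulmxA mulVmx //.
by rewrite mulmx1 !mxE mulr1.
Qed.

Lemma basis_inP s (D : 'M[R]_(n, s)) B :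
  basis_in D B <-> B \in unitmx /\ forall i, exists j, col i B = col j D.
Proof.
rewrite /basis_in basis_colsP; split=> -[uB h]; split=> //.
  move=> i; have /h/mapP[j _ ->] : col i B \in cols B.
    by apply: map_f; rewrite mem_enum.
  by exists j.
by move=> _ /mapP[i _ ->]; have [j ->] := h i; apply: map_f; rewrite mem_enum.
Qed.

(** * Antipodal pairs and the equality of [gamma B] and [pmax D B] *)

Section MaximalPositiveBasis.
Variable D : 'M[R]_(n, (2 * n)%N).
Hypothesis hD : max_pos_basis D.

Lemma col_antipode j : exists k l, 0 < l /\ col k D = - (l *: col j D).
Proof.
have [[ind full] _] := hD.
have [||k [l l0 e]] := @antipode R 'cV[R]_n 'I_(2 * n) (fun j => col j D) ind _ j.
- by move=> v; have : [set: 'cV[R]_n] v by []; rewrite -full.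
- by rewrite card_ord dim_cV.
by exists k, l.
Qed.

Lemma col_neq0 j : col j D <> 0.
Proof.
move=> e; have [[ind _] _] := hD; apply: (ind j); rewrite e.
exact: (cone0 (fun i => col i D)).
Qed.

(** With [f i] an index of column [i] of [B] in [D] and [g i] one of its antipode, these 2n indices
    are distinct and so exhaust [D]. *)
Lemma basis_cover B : basis_in D B -> forall j, exists i,
  col j D = col i B \/ exists2 l, 0 < l & col j D = - (l *: col i B).
Proof.
move=> /basis_inP[uB /choice[f hf]].
have [g hg] := choice (fun i => col_antipode (f i)).
have [l hl] := choice hg.
have injB i k c : col i B = c *: col k B -> i = k.
  move=> e; apply/eqP/negP => /negP ik.
  move: e; rewrite !colE scalemxAr => /(can_inj (mulKmx uB))/colP/(_ i).
  by rewrite !mxE !eqxx (negPf ik) mulr0 => /eqP; rewrite oner_eq0.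
have finj : injective f.
  by move=> i k e; apply: (@injB _ _ 1); rewrite scale1r !hf e.
have ginj : injective g.
  move=> i k e; have [li ei] := hl i; have [lk ek] := hl k.
  apply: (@injB _ _ ((l i)^-1 * l k)); rewrite -scalerA !hf.
  have -> : l k *: col (f k) D = l i *: col (f i) D.
    by apply: oppr_inj; rewrite -ek -ei e.
  by rewrite scalerA mulVf ?scale1r // gt_eqF.
(* Equality would make column [i] of [B] a negative multiple of column [k]; then [i = k] and the
   column is zero. *)
have fg i k : f i != g k.
  apply/eqP => e; have [lk ek] := hl k.
  have ik : i = k by apply: (@injB _ _ (- l k)); rewrite !hf e ek scaleNr.
  apply: (@col_neq0 (f k)); apply/eqP; move: ek; rewrite -e ik => /eqP.
  rewrite -addr_eq0 -{1}[col _ _]scale1r -scalerDl scaler_eq0.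
  by rewrite gt_eqF // addr_gt0.
pose h (x : 'I_n + 'I_n) := match x with inl i => f i | inr i => g i end.
have hinj : injective h.
  move=> [i|i] [k|k] /= e; [congr inl; exact: finj| | |congr inr; exact: ginj].
    by have := fg i k; rewrite e eqxx.
  by have := fg k i; rewrite e eqxx.
move=> j; have /codomP[[i|i] ->] : j \in codom h.
  by rewrite (inj_card_onto hinj) // card_sum !card_ord mul2n addnn.
- by exists i; left; rewrite hf.
by exists i; right; have [li ei] := hl i; exists (l i); rewrite ?hf.
Qed.

Lemma pmaxE B : basis_in D B -> gamma B = pmax D B.
Proof.
move=> hB; have [uB sB] := (basis_inP _ _).1 hB.
have pE j : pvec D B 0 j = dot (uvec B) (col j D) by rewrite dot_col.
symmetry; apply: greatestE.
  by have [j e] := sB (Ordinal n0); exists j => //; rewrite pE -e dot_uvec_col.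
move=> _ [j _ <-]; rewrite pE; have [i [->|[l l0 ->]]] := basis_cover hB j.
  by rewrite dot_uvec_col.
rewrite dotNr dotZr dot_uvec_col //; have := gamma_gt0 uB.
by move=> g0; rewrite (le_trans _ (ltW g0)) // oppr_le0 mulr_ge0 // ltW.
Qed.

Lemma exists_basis : exists B, basis_in D B.
Proof.
have rD : row_full D^T.
  have [[_ full] _] := hD.
  have /choice[X hX] k : exists x, col k 1%:M = D *m x.
    have : [set: 'cV[R]_n] (col k 1%:M) by [].
    rewrite -full => -[a _ ->]; exists (\col_j a j); apply/colP => i.
    rewrite mxE summxE; apply: eq_big => [j|j _]; first by rewrite inE.
    by rewrite !mxE mulrC.
  apply/row_fullP; exists (\matrix_(i, j) X i j 0); apply/matrixP => i j.
  have /colP/(_ j) := hX i; rewrite !mxE eq_sym => ->.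
  by apply: eq_bigr => k _; rewrite !mxE mulrC.
(* [fullrankfun] selects n independent rows of [D^T], that is, columns of [D]. *)
exists (rowsub (fullrankfun rD) D^T)^T; apply/basis_inP; split.
  by rewrite unitmx_tr fullrowsub_unit.
by move=> i; exists (fullrankfun rD i); apply/colP => k; rewrite !mxE.
Qed.

(** * The cosine measure for unit vectors *)

Hypothesis unitD : forall j, enorm (col j D) = 1.

Lemma col_opp j : exists k, col k D = - col j D.
Proof.
have [k [l [l0 e]]] := col_antipode j; exists k; rewrite e.
have /enorm1 := unitD k; rewrite e -scaleNr dotZl dotZr.
have /enorm1-> := unitD j; rewrite mulr1 mulrNN.
move=> l1; suff -> : l = 1 by rewrite scaleN1r.
by apply/eqP; rewrite -(@eqrXn2 _ 2) ?expr1n ?expr2 ?ltW ?l1.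
Qed.

Lemma gamma_le_max u m : enorm u = 1 -> (forall j, dot u (col j D) <= m) ->
  exists2 B, basis_in D B & gamma B <= m.
Proof.
move=> u1 um; have [B0 /basis_inP[uB0 sB0]] := exists_basis.
pose x := invmx B0 *m u.
(* Signs of the coordinates of [u] in [B0]: after flipping, the coordinates are the [|x i 0|], and
   [col_opp] keeps the flipped columns in [D]. *)
pose t : 'rV[R]_n := \row_i (if 0 <= x i 0 then 1 else -1).
have tt i : t 0 i * t 0 i = 1.
  by rewrite mxE; case: ifP => _; rewrite ?mulr1 // mulrNN mulr1.
pose B := B0 *m diag_mx t.
have colB i : col i B = t 0 i *: col i B0.
  by apply/colP => k; rewrite /B mul_mx_diag !mxE mulrC.
have hB : basis_in D B.
  apply/basis_inP; split.
    rewrite unitmx_mul uB0 /=.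
    suff /mulmx1_unit[] : diag_mx t *m diag_mx t = 1%:M by [].
    apply/matrixP => i j; rewrite mul_mx_diag mxE [diag_mx _ _ _]mxE [RHS]mxE.
    have [->|_] := eqVneq i j; last by rewrite mulr0n mul0r.
    by rewrite !mulr1n tt.
  move=> i; rewrite colB mxE; have [j ->] := sB0 i.
  case: ifP => _; first by exists j; rewrite scale1r.
  by have [k ek] := col_opp j; exists k; rewrite ek scaleN1r.
have [uB sB] := (basis_inP _ _).1 hB.
pose S := \sum_i `|x i 0|.
have uE v : dot v u = \sum_i dot v (col i B) * `|x i 0|.
  rewrite -[u in LHS](mulKVmx uB0) -/x dot_mul; apply: eq_bigr => i _.
  rewrite colB dotZr [t _ _]mxE; case: ger0P => _; first by rewrite mul1r.
  by rewrite mulN1r mulrNN.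
have S1 : 1 <= m * S.
  have /enorm1 := u1; rewrite uE => <-; rewrite mulr_sumr; apply: ler_sum => i _.
  by rewrite ler_wpM2r //; have [j ->] := sB i.
have gS : gamma B * S <= 1.
  have := dot_le1 (enorm_uvec uB) u1; rewrite uE => /(le_trans _); apply.
  rewrite mulr_sumr; apply: ler_sum => i _.
  by rewrite dot_uvec_col.
exists B => //.
(* [S = 0] would contradict [1 <= m * S]; then [gamma B * S <= 1 <= m * S] is divided by [S]. *)
have S0 : 0 < S.
  rewrite lt_def sumr_ge0 // andbT; apply: contraTneq S1 => ->.
  by rewrite mulr0 ler10.
by rewrite -(ler_pM2r S0) (le_trans gS).
Qed.

(** Each basis in [D] is a selection of columns by one of finitely many functions, so the minimum is
    attained. *)
Lemma exists_min_gamma : exists2 B, basis_in D B &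
  forall B', basis_in D B' -> gamma B <= gamma B'.
Proof.
pose M (f : {ffun 'I_n -> 'I_(2 * n)}) := colsub f D.
have ME B : basis_in D B -> exists f, B = M f.
  move=> /basis_inP[_ /choice[f hf]]; exists (finfun f); apply/matrixP => i j.
  by have /colP/(_ i) := hf j; rewrite !mxE ffunE.
have [B0 hB0] := exists_basis; have [f0 e0] := ME _ hB0.
have P0 : `[< basis_in D (M f0) >] by apply/asboolP; rewrite -e0.
have [f /asboolP hf minf] :=
  @arg_minP _ _ _ f0 (fun f => `[< basis_in D (M f) >]) (fun f => gamma (M f)) P0.
exists (M f) => // B' hB'; have [f' e'] := ME _ hB'; rewrite e'; apply: minf.
by apply/asboolP; rewrite -e'.
Qed.

Lemma cm_max_pos_basis :
  cm D = least [set gamma B | B in [set B : 'M[R]_n | basis_in D B]].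
Proof.
have [B hB minB] := exists_min_gamma.
have [uB sB] := (basis_inP _ _).1 hB.
have quotE u j : dot u (col j D) / enorm (col j D) = dot u (col j D).
  by rewrite unitD divr1.
rewrite [RHS](@leastE _ _ (gamma B)); last 2 first.
- by exists B.
- by move=> _ [B' hB' <-]; exact: minB.
apply: leastE.
  (* The minimum is attained at [uvec B], where the maximum over [D] is [pmax D B]. *)
  exists (uvec B); first exact: enorm_uvec.
  rewrite (pmaxE hB) /pmax; congr greatest; apply: eq_imagel => j _.
  by rewrite quotE dot_col.
move=> _ [u u1 <-]; have [j0 _] := sB (Ordinal n0).
have [j -> maxj] := greatest_finite j0 (fun j => dot u (col j D) / enorm (col j D)).
have [|B' hB' leB'] := @gamma_le_max u (dot u (col j D) / enorm (col j D)) u1.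
  by move=> k; rewrite -quotE.
exact: le_trans (minB _ hB') leB'.
Qed.

End MaximalPositiveBasis.
End CosineMeasure.

Theorem theorem22 (R : realType) (n : nat) (hn : (0 < n)%N)
    (D : 'M[R]_(n, (2 * n)%N)) (hD : max_pos_basis D) :
  (forall B : 'M[R]_n, basis_in D B -> gamma B = pmax D B) /\
  ((forall j, enorm (col j D) = 1) ->
   cm D = least [set gamma B | B in [set B : 'M[R]_n | basis_in D B]]).
Proof.
by split=> [B|]; [exact: pmaxE|exact: cm_max_pos_basis].
Qed.
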